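(* For every $K>1$, the constant $$c_1=\mu^{-1}\left(\log\frac{\sqrt K+1}{\sqrt K-1}\right)$$ satisfies $$\frac{K-1}{K+1}<c_1<2\,\frac{K-1}{\sqrt K+1}.$$
   Context: $\mu:(0,1)\to(0,\infty)$ is the decreasing homeomorphism $\mu(r)=\frac{\pi}{2}\,\frac{\mathcal K(\sqrt{1-r^2})}{\mathcal K(r)}$, where $\mathcal K(r)=\int_0^1\frac{dx}{\sqrt{(1-x^2)(1-r^2x^2)}}$ is Legendre's complete elliptic integral of the first kind. *)

(* Defs.v *)
From Stdlib Require Import Reals.
From Coquelicot Require Import Coquelicot.

Open Scope R_scope.

(* Improper at the right endpoint, hence the limit along [at_left 1]. *)
Definition ellipticK (r : R) : R :=
  RInt_gen (fun x : R => / sqrt ((1 - x ^ 2) * (1 - r ^ 2 * x ^ 2)))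
           (at_point 0) (at_left 1).

Definition mu (r : R) : R :=
  PI / 2 * (ellipticK (sqrt (1 - r ^ 2)) / ellipticK r).

(* Inverse of [mu] as a map from (0,1) to (0,+oo): Coquelicot's [iota] is the
   definite description operator, specified by [iota_correct] when exactly one
   point satisfies the predicate. *)
Definition mu_inv (y : R) : R :=
  iota (fun r : R => 0 < r < 1 /\ mu r = y).

(* Main.v *)
(* Write F for [ellipticK] and r' = sqrt (1 - r^2). Both bounds follow from
   artanh r' < mu r < ln (1 + 4 / r), since mu decreases: at r = (K-1)/(K+1) the
   left side is ln ((sqrt K + 1) / (sqrt K - 1)), and so is the right side at
   r = 2 (sqrt K - 1).

   The left inequality combines F(r) < pi / (2 r') with F(r') > artanh r' / r'.
   The right one combines the AM-GM bound F(r) >= pi / (1 + r') with an upper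
   bound for F(k), k = r', read off the Landen transform
   F(k) = 2/(1+k) * int_0^1 dt / sqrt ((b + t^2) (1 + b t^2)), b = (1-k)/(1+k),
   by dropping the factor 1 + b t^2. Each estimate of F is a pointwise comparison
   of the integrand with the derivative of an elementary function.

   That mu is onto follows from the intermediate value theorem, the identity
   mu r * mu r' = pi^2 / 4 and artanh r' < mu r. *)
Require Import Defs.
From Stdlib Require Import Reals Lra Ranalysis5 Classical.
From Coquelicot Require Import Coquelicot.
Open Scope R_scope.

(** * Improper integrals over [0,1): limits, antiderivatives, comparison *)

Notation int01 f l := (is_RInt_gen f (at_point 0) (at_left 1) l).

(** Half-open, because integrands such as [kint k] blow up at 1. *)
Definition cont01 (f : R -> R) : Prop :=
  forall x, 0 <= x < 1 -> continuous f x.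

Lemma at_left_above (a b : R) : a < b -> at_left b (fun x => a < x < b).
Proof.
  intros Hab.
  assert (He : 0 < b - a) by lra.
  exists (mkposreal _ He); intros x Hx Hxb.
  apply Rabs_def2 in Hx; unfold minus, plus, opp in Hx; simpl in Hx; lra.
Qed.

Lemma cont01_ex_RInt (f : R -> R) (a b : R) :
  cont01 f -> 0 <= a <= b -> b < 1 -> ex_RInt f a b.
Proof.
  intros Hf Hab Hb; apply (ex_RInt_continuous (V := R_CompleteNormedModule)).
  intros z; rewrite Rmin_left, Rmax_right by lra; intros Hz; apply Hf; lra.
Qed.

(** Only 0 is near [at_point 0], so the product filter in [is_RInt_gen] reduces to a one-sided limit
    of partial integrals; [filterlim_of_int01] is the converse. *)
Lemma int01_of_filterlim (f : R -> R) (l : R) :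
  cont01 f -> filterlim (fun x => RInt f 0 x) (at_left 1) (locally l) ->
  int01 f l.
Proof.
  intros Hf Hl P HP.
  apply (Filter_prod _ _ _ (fun a => a = 0)
           (fun x => 0 < x < 1 /\ P (RInt f 0 x))).
  - reflexivity.
  - apply filter_and; [apply at_left_above; lra | exact (Hl P HP)].
  - intros a x -> [Hx HPx]; exists (RInt f 0 x); split; [|exact HPx].
    apply (RInt_correct (V := R_CompleteNormedModule)).
    apply cont01_ex_RInt; auto; lra.
Qed.

Lemma filterlim_of_int01 (f : R -> R) (l : R) :
  int01 f l -> filterlim (fun x => RInt f 0 x) (at_left 1) (locally l).
Proof.
  intros H P HP.
  destruct (H P HP) as [Q S HQ HS HQS].
  unfold filtermap; revert HS; apply filter_imp; intros x Hx.
  destruct (HQS 0 x HQ Hx) as [v [Hv HPv]].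
  simpl in Hv; rewrite (is_RInt_unique _ _ _ _ Hv); exact HPv.
Qed.

Lemma filterlim_plus_const {F : (R -> Prop) -> Prop} {FF : Filter F}
    (f : R -> R) (l c : R) :
  filterlim f F (locally l) -> filterlim (fun x => f x + c) F (locally (l + c)).
Proof.
  intros Hf.
  apply (filterlim_comp_2 f (fun _ => c) Rplus Hf (filterlim_const c)).
  apply (filterlim_plus (V := R_NormedModule)).
Qed.

(** Fundamental theorem of calculus on each [0,x]; at 1 the antiderivative only has to have a left
    limit. *)
Lemma int01_derive (G g : R -> R) (l : R) :
  (forall x, 0 <= x < 1 -> is_derive G x (g x)) -> cont01 g ->
  filterlim G (at_left 1) (locally l) -> int01 g (l - G 0).
Proof.
  intros HG Hg Hl; apply int01_of_filterlim; [exact Hg|].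
  apply filterlim_ext_loc with (fun x => G x - G 0).
  - generalize (at_left_above 0 1 Rlt_0_1); apply filter_imp; intros x Hx.
    symmetry; apply is_RInt_unique.
    apply (is_RInt_derive (V := R_CompleteNormedModule));
      intros y; rewrite Rmin_left, Rmax_right by lra; intros Hy;
      [apply HG | apply Hg]; lra.
  - exact (filterlim_plus_const G l (- G 0) Hl).
Qed.

(** The excess of [g] over [f] accumulated on [0,x0] is never lost later, since [f <= g] on the
    rest. A bare passage to the limit gives only a weak inequality; a positive excess at some [x0]
    makes it strict. *)
Lemma int01_gap (f g : R -> R) (lf lg x0 : R) :
  cont01 f -> cont01 g -> (forall x, 0 < x < 1 -> f x <= g x) ->
  0 <= x0 < 1 -> int01 f lf -> int01 g lg ->
  RInt g 0 x0 - RInt f 0 x0 <= lg - lf.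
Proof.
  intros Hf Hg Hfg Hx0 If Ig.
  apply filterlim_of_int01 in If; apply filterlim_of_int01 in Ig.
  set (d := RInt g 0 x0 - RInt f 0 x0).
  enough (lf + d <= lg) by lra.
  apply (filterlim_le (F := at_left 1) (fun x => RInt f 0 x + d)
           (fun x => RInt g 0 x) (lf + d) lg); auto.
  - generalize (at_left_above x0 1 (proj2 Hx0)); apply filter_imp.
    intros x Hx; unfold d.
    rewrite <- (RInt_Chasles f 0 x0 x), <- (RInt_Chasles g 0 x0 x)
      by (apply cont01_ex_RInt; auto; lra).
    assert (RInt f x0 x <= RInt g x0 x).
    { apply RInt_le; try apply cont01_ex_RInt; auto; try lra.
      intros y Hy; apply Hfg; lra. }
    unfold plus; simpl; lra.
  - exact (filterlim_plus_const _ _ d If).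
Qed.

Lemma int01_le (f g : R -> R) (lf lg : R) :
  cont01 f -> cont01 g -> (forall x, 0 < x < 1 -> f x <= g x) ->
  int01 f lf -> int01 g lg -> lf <= lg.
Proof.
  intros Hf Hg Hfg If Ig.
  assert (Hgap := int01_gap f g lf lg 0 Hf Hg Hfg ltac:(lra) If Ig).
  rewrite !RInt_point in Hgap; unfold zero in Hgap; simpl in Hgap; lra.
Qed.

Lemma int01_lt (f g : R -> R) (lf lg : R) :
  cont01 f -> cont01 g -> (forall x, 0 < x < 1 -> f x < g x) ->
  int01 f lf -> int01 g lg -> lf < lg.
Proof.
  intros Hf Hg Hfg If Ig.
  assert (Hgap : RInt g 0 (1/2) - RInt f 0 (1/2) <= lg - lf).
  { apply int01_gap; auto; try lra. intros x Hx; apply Rlt_le, Hfg, Hx. }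
  assert (RInt f 0 (1/2) < RInt g 0 (1/2)).
  { apply RInt_lt; try lra; intros x Hx;
      [apply Hg | apply Hf | apply Hfg]; lra. }
  lra.
Qed.

Lemma int01_const0 : int01 (fun _ => 0) 0.
Proof.
  assert (H : int01 (fun _ => 0) (0 - 0)).
  { apply (int01_derive (fun _ => 0)).
    - intros x _; exact (is_derive_const 0 x).
    - intros x _; apply continuous_const.
    - apply filterlim_const. }
  rewrite Rminus_0_r in H; exact H.
Qed.

(** The partial integrals of [f >= 0] increase and are bounded by [lg], so they converge to their
    supremum. *)
Lemma int01_dominated (f g : R -> R) (lg : R) :
  cont01 f -> cont01 g -> (forall x, 0 <= x < 1 -> 0 <= f x <= g x) ->
  int01 g lg -> exists l, int01 f l.
Proof.
  intros Hf Hg Hfg Ig.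
  assert (Hmono : forall a b, 0 <= a <= b -> b < 1 -> RInt f 0 a <= RInt f 0 b).
  { intros a b Hab Hb.
    rewrite <- (RInt_Chasles f 0 a b) by (apply cont01_ex_RInt; auto; lra).
    assert (0 <= RInt f a b).
    { apply RInt_ge_0; [lra | apply cont01_ex_RInt; auto; lra |].
      intros x Hx; apply Hfg; lra. }
    unfold plus; simpl; lra. }
  assert (Hbound : forall x, 0 <= x < 1 -> RInt f 0 x <= lg).
  { intros x Hx.
    (* Comparing the zero function with [g] bounds the partial integrals of [g] by [lg]. *)
    assert (H0 := int01_gap _ _ _ _ x (fun y _ => continuous_const _ _) Hg
              (fun y Hy => Rle_trans _ _ _ (proj1 (Hfg y ltac:(lra)))
                             (proj2 (Hfg y ltac:(lra))))
              Hx int01_const0 Ig).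
    rewrite RInt_const in H0; unfold scal in H0; simpl in H0; unfold mult in H0;
      simpl in H0.
    assert (RInt f 0 x <= RInt g 0 x).
    { apply RInt_le; try apply cont01_ex_RInt; auto; try lra.
      intros y Hy; apply Hfg; lra. }
    lra. }
  destruct (completeness (fun v => exists x, 0 <= x < 1 /\ v = RInt f 0 x))
    as [l [Hub Hlub]].
  - exists lg; intros v [x [Hx ->]]; auto.
  - exists (RInt f 0 0), 0; split; [lra | reflexivity].
  - exists l; apply int01_of_filterlim; [exact Hf|].
    apply filterlim_locally; intros eps.
    (* Some partial integral is within [eps] of the supremum; by monotonicity so are all later
       ones. *)
    assert (Hx : exists x, 0 <= x < 1 /\ l - eps < RInt f 0 x).
    { apply NNPP; intros Hno.
      assert (l <= l - eps).
      { apply Hlub; intros v [x [Hx ->]].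
        apply Rnot_lt_le; intros Hlt; apply Hno; eauto. }
      destruct eps; simpl in *; lra. }
    destruct Hx as [x [Hx Hlx]].
    generalize (at_left_above x 1 (proj2 Hx)); apply filter_imp; intros y Hy.
    assert (RInt f 0 x <= RInt f 0 y) by (apply Hmono; lra).
    assert (RInt f 0 y <= l)
      by (apply Hub; exists y; split; [lra | reflexivity]).
    apply Rabs_def1; unfold minus, plus, opp; simpl; lra.
Qed.

(** * The integrand of the elliptic integral *)

Definition kint (k x : R) : R := / sqrt ((1 - x ^ 2) * (1 - k ^ 2 * x ^ 2)).

Lemma sq_lt_1 (x : R) : 0 <= x < 1 -> 0 < 1 - x ^ 2.
Proof. intros Hx; nra. Qed.

Lemma modulus_lt_1 (k x : R) : 0 <= k < 1 -> 0 <= x <= 1 -> 0 < 1 - k ^ 2 * x ^ 2.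
Proof.
  intros Hk Hx; assert (0 <= k * x < 1) by nra.
  replace (k ^ 2 * x ^ 2) with ((k * x) ^ 2) by ring; apply sq_lt_1; lra.
Qed.

Lemma kint_split (k x : R) : 0 <= k < 1 -> 0 <= x < 1 ->
  kint k x = / (sqrt (1 - x ^ 2) * sqrt (1 - k ^ 2 * x ^ 2)).
Proof.
  intros Hk Hx; unfold kint; rewrite sqrt_mult_alt; [reflexivity|].
  apply Rlt_le, sq_lt_1, Hx.
Qed.

Lemma kint_pos (k x : R) : 0 <= k < 1 -> 0 <= x < 1 -> 0 < kint k x.
Proof.
  intros Hk Hx; apply Rinv_0_lt_compat, sqrt_lt_R0, Rmult_lt_0_compat.
  - apply sq_lt_1, Hx.
  - apply modulus_lt_1; lra.
Qed.

Lemma cont01_kint (k : R) : 0 <= k < 1 -> cont01 (kint k).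
Proof.
  intros Hk x Hx; apply (ex_derive_continuous (V := R_NormedModule)).
  assert (H1 := sq_lt_1 x Hx).
  assert (H2 := modulus_lt_1 k x Hk ltac:(lra)).
  assert (H3 := Rmult_lt_0_compat _ _ H1 H2).
  assert (H4 := sqrt_lt_R0 _ H3).
  unfold kint; auto_derive; unfold Rminus in *; simpl in *; repeat split;
    try apply Rgt_not_eq; lra.
Qed.

Lemma cont01_scal (a : R) (f : R -> R) : cont01 f -> cont01 (fun x => a * f x).
Proof.
  intros Hf x Hx.
  exact (continuous_scal_r (V := R_NormedModule) a f x (Hf x Hx)).
Qed.

(** * Comparison integrals with elementary antiderivatives *)

Lemma filterlim_at_left_of_continuous (h : R -> R) (a : R) :
  continuous h a -> filterlim h (at_left a) (locally (h a)).
Proof.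
  intros Hh P HP; apply filter_le_within; exact (Hh P HP).
Qed.

(** Derivative of [a / sqrt c * atan (sqrt c * x / sqrt (1 - x ^ 2))]. It serves twice: [c = 1]
    gives the upper bound for [kint k], and [c = sqrt (1 - k ^ 2)] the AM-GM lower bound. *)
Definition atan_int (a c x : R) : R :=
  a / (sqrt (1 - x ^ 2) * (1 - (1 - c) * x ^ 2)).

Lemma atan_int_den (c x : R) : 0 < c <= 1 -> 0 <= x < 1 ->
  0 < 1 - (1 - c) * x ^ 2.
Proof. intros Hc Hx; assert (H := sq_lt_1 x Hx); nra. Qed.

Lemma cont01_atan_int (a c : R) : 0 < c <= 1 -> cont01 (atan_int a c).
Proof.
  intros Hc x Hx; apply (ex_derive_continuous (V := R_NormedModule)).
  assert (H1 := sq_lt_1 x Hx).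
  assert (H2 := atan_int_den c x Hc Hx).
  assert (H4 := sqrt_lt_R0 _ H1).
  unfold atan_int; auto_derive; unfold Rminus in *; simpl in *; repeat split;
    [lra | apply Rgt_not_eq, Rmult_lt_0_compat; lra].
Qed.

Lemma int01_atan_int (a c : R) : 0 < c <= 1 ->
  int01 (atan_int a c) (a * PI / (2 * sqrt c)).
Proof.
  intros Hc.
  assert (Hsc : 0 < sqrt c) by (apply sqrt_lt_R0; lra).
  set (G := fun x => a / sqrt c * atan (sqrt c * x / sqrt (1 - x ^ 2))).
  replace (a * PI / (2 * sqrt c)) with (a / sqrt c * (PI / 2) - G 0).
  2:{ unfold G; rewrite Rmult_0_r, Rdiv_0_l, atan_0; field; lra. }
  apply int01_derive; [| apply cont01_atan_int, Hc |].
  - intros x Hx.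
    assert (H1 := sq_lt_1 x Hx).
    assert (H2 := atan_int_den c x Hc Hx).
    assert (H4 := sqrt_lt_R0 _ H1).
    assert (E1 : sqrt (1 - x ^ 2) ^ 2 = 1 - x ^ 2) by (apply pow2_sqrt; lra).
    assert (Ec : sqrt c ^ 2 = c) by (apply pow2_sqrt; lra).
    unfold G, atan_int; auto_derive.
    { unfold Rminus in *; simpl in *; repeat split; try apply Rgt_not_eq; lra. }
    replace (x * (x * 1)) with (x ^ 2) in * by ring.
    change (1 + - x ^ 2) with (1 - x ^ 2).
    set (u := sqrt (1 - x ^ 2)) in *; set (d := sqrt c) in *.
    assert (D1 : 0 < u ^ 2 + d ^ 2 * x ^ 2) by nra.
    assert (E3 : 1 - (1 - c) * x ^ 2 = u ^ 2 + d ^ 2 * x ^ 2)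
      by (rewrite E1, Ec; ring).
    rewrite E3.
    (* What is left is an identity modulo [u ^ 2 + x ^ 2 = 1]. *)
    assert (E4 : x ^ 2 = 1 - u ^ 2) by lra.
    field_simplify_eq; [| repeat split; nra].
    transitivity ((u ^ 2 + x ^ 2) * (2 * a * d ^ 3 * x ^ 2 + 2 * a * d * u ^ 2));
      [ring | replace (u ^ 2 + x ^ 2) with 1 by lra; ring].
  (* The argument of [atan] tends to infinity at 1; [atan y = PI / 2 - atan (/ y)] turns [G] into a
     function continuous there. *)
  - apply filterlim_ext_loc with
      (fun x => a / sqrt c * (PI / 2 - atan (sqrt (1 - x ^ 2) / (sqrt c * x)))).
    + generalize (at_left_above 0 1 Rlt_0_1); apply filter_imp; intros x Hx.
      assert (H1 := sq_lt_1 x ltac:(lra)).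
      assert (H4 := sqrt_lt_R0 _ H1).
      unfold G; rewrite <- atan_inv.
      * do 2 f_equal; field; repeat split; nra.
      * apply Rdiv_lt_0_compat; [lra | apply Rmult_lt_0_compat; lra].
    + set (h := fun x => _).
      replace (a / sqrt c * (PI / 2)) with (h 1).
      2:{ unfold h; replace (1 - 1 ^ 2) with 0 by ring.
          rewrite sqrt_0, Rdiv_0_l, atan_0; ring. }
      apply filterlim_at_left_of_continuous; unfold h.
      apply (continuous_scal_r (V := R_NormedModule)).
      apply (continuous_minus (V := R_NormedModule)); [apply continuous_const|].
      apply (continuous_comp (fun x => sqrt (1 - x ^ 2) / (sqrt c * x)) atan).
      * apply (continuous_mult (K := R_AbsRing)).
        -- apply continuous_comp with (g := sqrt); [|apply continuous_sqrt].
           apply (ex_derive_continuous (V := R_NormedModule)); auto_derive; auto.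
        -- apply (ex_derive_continuous (V := R_NormedModule)); auto_derive; lra.
      * apply (ex_derive_continuous (V := R_NormedModule)); auto_derive; auto.
Qed.

Definition artanh (x : R) : R := ln ((1 + x) / (1 - x)) / 2.

Lemma cont01_artanh_int (k : R) : 0 < k < 1 ->
  cont01 (fun x => / (1 - k ^ 2 * x ^ 2)).
Proof.
  intros Hk x Hx; apply (ex_derive_continuous (V := R_NormedModule)).
  assert (H := modulus_lt_1 k x ltac:(lra) ltac:(lra)).
  auto_derive; simpl in *; lra.
Qed.

(** Partial fractions. As [k < 1], the antiderivative is differentiable at 1 too, so its left limit
    is its value. *)
Lemma int01_artanh_int (k : R) : 0 < k < 1 ->
  int01 (fun x => / (1 - k ^ 2 * x ^ 2)) (artanh k / k).
Proof.
  intros Hk.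
  set (G := fun x => (ln (1 + k * x) - ln (1 - k * x)) / (2 * k)).
  assert (HG : forall x, 0 <= x <= 1 -> is_derive G x (/ (1 - k ^ 2 * x ^ 2))).
  { intros x Hx; assert (k * x < 1) by nra; assert (0 <= k * x) by nra.
    unfold G; auto_derive; [repeat split; lra|].
    field; repeat split; nra. }
  replace (artanh k / k) with (G 1 - G 0).
  2:{ unfold G, artanh; rewrite !Rmult_1_r, !Rmult_0_r, Rplus_0_r, Rminus_0_r.
      rewrite ln_div by lra; field; lra. }
  apply int01_derive; [intros x Hx; apply HG; lra | apply cont01_artanh_int, Hk |].
  apply filterlim_at_left_of_continuous.
  apply (ex_derive_continuous (V := R_NormedModule)).
  eexists; apply HG; lra.
Qed.

(** Derivative of the Landen substitution [t = sqrt ((1 - x) / (1 + x))]. *)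
Lemma sqrt_ratio_derive (x : R) : 0 <= x < 1 ->
  is_derive (fun x => sqrt ((1 - x) / (1 + x))) x
    (- / ((1 + x) ^ 2 * sqrt ((1 - x) / (1 + x)))).
Proof.
  intros Hx.
  assert (H : 0 < (1 - x) / (1 + x)) by (apply Rdiv_lt_0_compat; lra).
  assert (Hs := sqrt_lt_R0 _ H).
  auto_derive; [unfold Rdiv, Rminus in *; repeat split; lra |].
  unfold Rdiv, Rminus in *; set (s := sqrt ((1 + - x) * / (1 + x))) in *.
  field; repeat split; lra.
Qed.

(* Bound for the Landen-transformed integrand, pulled back to [x] by
   [t = sqrt ((1 - x) / (1 + x))]; here [z = 1 / sqrt b] in the notation above. *)
Definition arcsinh_int (k x : R) : R :=
  let z := sqrt ((1 + k) / (1 - k)) in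
  let s := sqrt ((1 - x) / (1 + x)) in
  2 / (1 + k) * (z / ((1 + x) ^ 2 * s) * / sqrt ((z * s) ^ 2 + 1)).

Lemma cont01_arcsinh_int (k : R) : 0 < k < 1 -> cont01 (arcsinh_int k).
Proof.
  intros Hk x Hx; apply (ex_derive_continuous (V := R_NormedModule)).
  assert (H : 0 < (1 - x) / (1 + x)) by (apply Rdiv_lt_0_compat; lra).
  assert (Hs := sqrt_lt_R0 _ H).
  unfold arcsinh_int; set (z := sqrt ((1 + k) / (1 - k))).
  unfold Rdiv, Rminus in *.
  assert (H1 : 0 < (z * sqrt ((1 + - x) * / (1 + x)))
            * (z * sqrt ((1 + - x) * / (1 + x)) * 1) + 1) by nra.
  assert (H2 := sqrt_lt_R0 _ H1).
  auto_derive; repeat split; try apply Rgt_not_eq; try assumption; try lra.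
  apply Rmult_lt_0_compat; [nra | lra].
Qed.

Lemma int01_arcsinh_int (k : R) : 0 < k < 1 ->
  int01 (arcsinh_int k) (2 / (1 + k) * arcsinh (sqrt ((1 + k) / (1 - k)))).
Proof.
  intros Hk.
  set (z := sqrt ((1 + k) / (1 - k))).
  (* The minus sign appears because the substituted variable falls from 1 to 0. *)
  set (G := fun x => - (2 / (1 + k)) * arcsinh (z * sqrt ((1 - x) / (1 + x)))).
  replace (2 / (1 + k) * arcsinh z) with (G 1 - G 0).
  2:{ unfold G; replace ((1 - 1) / (1 + 1)) with 0 by field.
      replace ((1 - 0) / (1 + 0)) with 1 by field.
      rewrite sqrt_0, sqrt_1, Rmult_0_r, Rmult_1_r, arcsinh_0; ring. }
  apply int01_derive; [| apply cont01_arcsinh_int, Hk |].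
  - intros x Hx; unfold G.
    assert (Hs := sqrt_ratio_derive x Hx).
    set (w := z * sqrt ((1 - x) / (1 + x))).
    assert (Ha : is_derive arcsinh w (/ sqrt (w ^ 2 + 1)))
      by (apply is_derive_Reals, derivable_pt_lim_arcsinh).
    assert (Hd := is_derive_scal _ x (- (2 / (1 + k))) _
       (is_derive_comp arcsinh (fun x => z * sqrt ((1 - x) / (1 + x))) x _ _ Ha
          (is_derive_scal _ x z _ Hs))).
    unfold scal in Hd; simpl in Hd; unfold mult in Hd; simpl in Hd.
    match type of Hd with is_derive _ _ ?l =>
      replace (arcsinh_int k x) with l; [exact Hd|] end.
    unfold arcsinh_int; fold z; fold w; unfold w; simpl; unfold Rdiv; ring.
  (* The square root is not differentiable where its argument vanishes, at [x = 1], so continuity is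
     obtained by composition. *)
  - apply filterlim_at_left_of_continuous; unfold G.
    apply (continuous_scal_r (V := R_NormedModule)).
    apply (continuous_comp (fun x => z * sqrt ((1 - x) / (1 + x))) arcsinh).
    + apply (continuous_scal_r (V := R_NormedModule)).
      apply continuous_comp with (g := sqrt); [|apply continuous_sqrt].
      apply (ex_derive_continuous (V := R_NormedModule)); auto_derive; lra.
    + apply (ex_derive_continuous (V := R_NormedModule)).
      eexists; apply is_derive_Reals, derivable_pt_lim_arcsinh.
Qed.

(** * Elementary bounds for [ellipticK] *)

Lemma compl_sqrt (k : R) : 0 < k < 1 ->
  0 < sqrt (1 - k ^ 2) < 1 /\ sqrt (1 - k ^ 2) ^ 2 = 1 - k ^ 2.
Proof.
  intros Hk; assert (H := sq_lt_1 k ltac:(lra)).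
  assert (E : sqrt (1 - k ^ 2) ^ 2 = 1 - k ^ 2) by (apply pow2_sqrt; lra).
  assert (H1 := sqrt_lt_R0 _ H); split; [split; nra | exact E].
Qed.

(** Since [x < 1], the factor [1 - k ^ 2 * x ^ 2] exceeds [1 - k ^ 2]. *)
Lemma kint_lt_atan_int (k x : R) : 0 < k < 1 -> 0 <= x < 1 ->
  kint k x < atan_int (/ sqrt (1 - k ^ 2)) 1 x.
Proof.
  intros Hk Hx; rewrite kint_split by lra; unfold atan_int.
  destruct (compl_sqrt k Hk) as [Hc _].
  assert (H1 := sqrt_lt_R0 _ (sq_lt_1 x Hx)).
  replace (1 - (1 - 1) * x ^ 2) with 1 by ring.
  unfold Rdiv; rewrite Rmult_1_r, <- Rinv_mult, (Rmult_comm _ (sqrt (1 - x ^ 2))).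
  apply Rinv_lt_contravar.
  - repeat apply Rmult_lt_0_compat; try lra.
    apply sqrt_lt_R0, modulus_lt_1; lra.
  - apply Rmult_lt_compat_l; [lra|]; apply sqrt_lt_1_alt.
    assert (H := sq_lt_1 x Hx); assert (0 < k ^ 2) by nra; nra.
Qed.

(** Convergence of the defining integral, by domination; it lets the total operator [RInt_gen] be
    used as a genuine integral. *)
Lemma int01_kint (k : R) : 0 < k < 1 -> int01 (kint k) (ellipticK k).
Proof.
  intros Hk.
  destruct (compl_sqrt k Hk) as [Hc _].
  assert (Hdom : forall x, 0 <= x < 1 ->
            0 <= kint k x <= atan_int (/ sqrt (1 - k ^ 2)) 1 x).
  { intros x Hx; split; apply Rlt_le;
      [apply kint_pos | apply kint_lt_atan_int]; lra. }
  destruct (int01_dominated _ _ _ (cont01_kint k ltac:(lra))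
              (cont01_atan_int _ 1 ltac:(lra)) Hdom
              (int01_atan_int _ 1 ltac:(lra))) as [l Hl].
  replace (ellipticK k) with l; [exact Hl|].
  symmetry; exact (is_RInt_gen_unique (kint k) l Hl).
Qed.

Lemma ellipticK_lt (k : R) : 0 < k < 1 ->
  ellipticK k < PI / (2 * sqrt (1 - k ^ 2)).
Proof.
  intros Hk; destruct (compl_sqrt k Hk) as [Hc _].
  replace (PI / (2 * sqrt (1 - k ^ 2)))
    with (/ sqrt (1 - k ^ 2) * PI / (2 * sqrt 1))
    by (rewrite sqrt_1; field; lra).
  apply (int01_lt (kint k) (atan_int (/ sqrt (1 - k ^ 2)) 1)).
  - apply cont01_kint; lra.
  - apply cont01_atan_int; lra.
  - intros x Hx; apply kint_lt_atan_int; lra.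
  - apply int01_kint, Hk.
  - apply int01_atan_int; lra.
Qed.

Lemma ellipticK_ge (k : R) : 0 < k < 1 ->
  PI / (1 + sqrt (1 - k ^ 2)) <= ellipticK k.
Proof.
  intros Hk; destruct (compl_sqrt k Hk) as [Hc Ec].
  set (c := sqrt (1 - k ^ 2)) in *.
  assert (Hd := sqrt_lt_R0 c ltac:(lra)).
  assert (Ed : sqrt c ^ 2 = c) by (apply pow2_sqrt; lra).
  replace (PI / (1 + c)) with (2 * sqrt c / (1 + c) * PI / (2 * sqrt c))
    by (field; lra).
  apply (int01_le (atan_int (2 * sqrt c / (1 + c)) c) (kint k)).
  - apply cont01_atan_int; lra.
  - apply cont01_kint; lra.
  - intros x Hx; rewrite kint_split by lra; unfold atan_int.
    assert (H1 := sqrt_lt_R0 _ (sq_lt_1 x ltac:(lra))).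
    assert (H2 := modulus_lt_1 k x ltac:(lra) ltac:(lra)).
    assert (H3 := sqrt_lt_R0 _ H2).
    assert (E3 : sqrt (1 - k ^ 2 * x ^ 2) ^ 2 = 1 - k ^ 2 * x ^ 2)
      by (apply pow2_sqrt; lra).
    set (u := sqrt (1 - x ^ 2)) in *; set (w := sqrt (1 - k ^ 2 * x ^ 2)) in *.
    set (d := sqrt c) in *.
    (* This factorisation brings the denominator [c + w ^ 2] produced by AM-GM into the form of
       [atan_int]. *)
    assert (E4 : (1 + c) * (1 - (1 - c) * x ^ 2) = c + w ^ 2).
    { rewrite E3; replace (k ^ 2) with (1 - c ^ 2) by lra; ring. }
    assert (H5 : 0 < c + w ^ 2) by nra.
    assert (H6 : 0 < 1 - (1 - c) * x ^ 2) by (apply atan_int_den; lra).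
    replace (2 * d / (1 + c) / (u * (1 - (1 - c) * x ^ 2)))
      with (2 * d / (u * (c + w ^ 2)))
      by (rewrite <- E4; field; repeat split; lra).
    replace (/ (u * w)) with ((c + w ^ 2) / w / (u * (c + w ^ 2)))
      by (field; repeat split; lra).
    apply Rmult_le_compat_r; [apply Rlt_le, Rinv_0_lt_compat; nra|].
    (* AM-GM with [c = d ^ 2] *)
    apply Rmult_le_reg_r with w; [lra|].
    replace ((c + w ^ 2) / w * w) with (c + w ^ 2) by (field; lra).
    assert (0 <= (d - w) ^ 2) by apply pow2_ge_0; lra.
  - apply int01_atan_int; lra.
  - apply int01_kint, Hk.
Qed.

(** For [x > 0], [1 - x ^ 2 < 1 - k ^ 2 * x ^ 2], so the product under the root is below
    [(1 - k ^ 2 * x ^ 2) ^ 2]. *)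
Lemma ellipticK_gt_artanh (k : R) : 0 < k < 1 -> artanh k / k < ellipticK k.
Proof.
  intros Hk.
  apply (int01_lt (fun x => / (1 - k ^ 2 * x ^ 2)) (kint k)).
  - apply cont01_artanh_int, Hk.
  - apply cont01_kint; lra.
  - intros x Hx; unfold kint.
    assert (H1 := sq_lt_1 x ltac:(lra)).
    assert (H2 := modulus_lt_1 k x ltac:(lra) ltac:(lra)).
    assert (H3 : 0 < (1 - x ^ 2) * (1 - k ^ 2 * x ^ 2)) by nra.
    apply Rinv_lt_contravar.
    + apply Rmult_lt_0_compat; [apply sqrt_lt_R0|]; lra.
    + rewrite <- (sqrt_pow2 (1 - k ^ 2 * x ^ 2)) at 2 by lra.
      apply sqrt_lt_1_alt; split; [lra|].
      assert (0 < (1 - k ^ 2) * x ^ 2)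
        by (apply Rmult_lt_0_compat; [apply sq_lt_1; lra | nra]).
      nra.
  - apply int01_artanh_int, Hk.
  - apply int01_kint, Hk.
Qed.

Lemma ellipticK_le_arcsinh (k : R) : 0 < k < 1 ->
  ellipticK k <= 2 / (1 + k) * arcsinh (sqrt ((1 + k) / (1 - k))).
Proof.
  intros Hk.
  apply (int01_le (kint k) (arcsinh_int k)).
  - apply cont01_kint; lra.
  - apply cont01_arcsinh_int, Hk.
  - intros x Hx.
    assert (Hp := kint_pos k x ltac:(lra) ltac:(lra)).
    assert (H1 := sq_lt_1 x ltac:(lra)).
    assert (H2 := modulus_lt_1 k x ltac:(lra) ltac:(lra)).
    assert (H3 : 0 < (1 + k) / (1 - k)) by (apply Rdiv_lt_0_compat; lra).
    assert (H4 : 0 < (1 - x) / (1 + x)) by (apply Rdiv_lt_0_compat; lra).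
    assert (E1 : kint k x ^ 2 = / ((1 - x ^ 2) * (1 - k ^ 2 * x ^ 2))).
    { unfold kint; rewrite pow_inv, pow2_sqrt by nra; reflexivity. }
    assert (E3 := pow2_sqrt _ (Rlt_le _ _ H3)).
    assert (E4 := pow2_sqrt _ (Rlt_le _ _ H4)).
    assert (P3 := sqrt_lt_R0 _ H3).
    assert (P4 := sqrt_lt_R0 _ H4).
    unfold arcsinh_int.
    set (z := sqrt ((1 + k) / (1 - k))) in *.
    set (s := sqrt ((1 - x) / (1 + x))) in *; cbv zeta.
    assert (H5 : 0 < (z * s) ^ 2 + 1) by nra.
    assert (P5 := sqrt_lt_R0 _ H5).
    assert (E5 := pow2_sqrt _ (Rlt_le _ _ H5)).
    assert (H6 : 0 < 1 - k * x) by nra.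
    set (q := sqrt ((z * s) ^ 2 + 1)) in *.
    assert (Pg : 0 < 2 / (1 + k) * (z / ((1 + x) ^ 2 * s) * / q)).
    { apply Rmult_lt_0_compat; [apply Rdiv_lt_0_compat; lra|].
      apply Rmult_lt_0_compat; [|apply Rinv_0_lt_compat, P5].
      apply Rdiv_lt_0_compat; [lra|]; apply Rmult_lt_0_compat; [nra | lra]. }
    (* Both sides are positive; squaring removes all the roots. *)
    apply Rsqr_incr_0; try lra; rewrite !Rsqr_pow2, E1.
    replace ((2 / (1 + k) * (z / ((1 + x) ^ 2 * s) * / q)) ^ 2)
      with (4 / (1 + k) ^ 2 * (z ^ 2 / ((1 + x) ^ 4 * s ^ 2)) / q ^ 2)
      by (field; repeat split; lra).
    rewrite E5, Rpow_mult_distr, E3, E4.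
    replace (4 / (1 + k) ^ 2 * ((1 + k) / (1 - k) / ((1 + x) ^ 4
               * ((1 - x) / (1 + x)))) / ((1 + k) / (1 - k) * ((1 - x) / (1 + x)) + 1))
      with (2 / ((1 + k) * (1 + x) * (1 - k * x) * (1 - x ^ 2)))
      by (field; repeat split; nra).
    (* The quotient of the squares is [2 * (1 + k * x) / ((1 + k) * (1 + x))], which is the dropped
       factor [1 + b t^2] written in [x]. *)
    replace (2 / ((1 + k) * (1 + x) * (1 - k * x) * (1 - x ^ 2)))
      with (2 * (1 + k * x) / ((1 + k) * (1 + x))
              * / ((1 - x ^ 2) * (1 - k ^ 2 * x ^ 2)))
      by (field; repeat split; nra).
    rewrite <- (Rmult_1_l (/ ((1 - x ^ 2) * (1 - k ^ 2 * x ^ 2)))) at 1.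
    apply Rmult_le_compat_r; [apply Rlt_le, Rinv_0_lt_compat; nra|].
    apply Rmult_le_reg_r with ((1 + k) * (1 + x)); [nra|].
    replace (2 * (1 + k * x) / ((1 + k) * (1 + x)) * ((1 + k) * (1 + x)))
      with (2 * (1 + k * x)) by (field; lra).
    (* The difference of the two sides is [(1 - k) * (1 - x)]. *)
    nra.
  - apply int01_kint, Hk.
  - apply int01_arcsinh_int, Hk.
Qed.

(** * Monotonicity and continuity of [ellipticK] *)

Lemma ellipticK_pos (k : R) : 0 < k < 1 -> 0 < ellipticK k.
Proof.
  intros Hk; apply Rlt_le_trans with (2 := ellipticK_ge k Hk).
  destruct (compl_sqrt k Hk) as [Hc _].
  apply Rdiv_lt_0_compat; [apply PI_RGT_0 | lra].
Qed.

Lemma ellipticK_incr (k1 k2 : R) : 0 < k1 -> k1 < k2 -> k2 < 1 ->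
  ellipticK k1 < ellipticK k2.
Proof.
  intros H1 H12 H2.
  apply (int01_lt (kint k1) (kint k2)); try (apply cont01_kint; lra);
    try (apply int01_kint; lra).
  intros x Hx; unfold kint.
  assert (Hx1 := sq_lt_1 x ltac:(lra)).
  assert (M1 := modulus_lt_1 k1 x ltac:(lra) ltac:(lra)).
  assert (M2 := modulus_lt_1 k2 x ltac:(lra) ltac:(lra)).
  apply Rinv_lt_contravar.
  - apply Rmult_lt_0_compat; apply sqrt_lt_R0; nra.
  - apply sqrt_lt_1_alt; split; [nra|].
    apply Rmult_lt_compat_l; [lra|].
    assert (k1 ^ 2 < k2 ^ 2) by nra; assert (0 < x ^ 2) by nra; nra.
Qed.

(** For [0 < x < 1] the quotient [(1 - k ^ 2) / (1 - k ^ 2 * x ^ 2)] decreases in [k], hence so does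
    the integrand. *)
Lemma compl_mul_ellipticK_decr (k1 k2 : R) : 0 < k1 -> k1 < k2 -> k2 < 1 ->
  sqrt (1 - k2 ^ 2) * ellipticK k2 < sqrt (1 - k1 ^ 2) * ellipticK k1.
Proof.
  intros H1 H12 H2.
  apply (int01_lt (fun x => sqrt (1 - k2 ^ 2) * kint k2 x)
           (fun x => sqrt (1 - k1 ^ 2) * kint k1 x));
    try (apply cont01_scal, cont01_kint; lra);
    try (apply (is_RInt_gen_scal (V := R_NormedModule)), int01_kint; lra).
  intros x Hx; rewrite !kint_split by lra.
  assert (Hx1 := sq_lt_1 x ltac:(lra)).
  assert (Hu := sqrt_lt_R0 _ Hx1).
  assert (M1 := modulus_lt_1 k1 x ltac:(lra) ltac:(lra)).
  assert (M2 := modulus_lt_1 k2 x ltac:(lra) ltac:(lra)).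
  assert (S1 := sqrt_lt_R0 _ M1); assert (S2 := sqrt_lt_R0 _ M2).
  assert (C1 := sq_lt_1 k1 ltac:(lra)); assert (C2 := sq_lt_1 k2 ltac:(lra)).
  (* Under the roots, the two sides differ by [(k2 ^ 2 - k1 ^ 2) * (1 - x ^ 2)]. *)
  assert (L : sqrt (1 - k2 ^ 2) * sqrt (1 - k1 ^ 2 * x ^ 2)
              < sqrt (1 - k1 ^ 2) * sqrt (1 - k2 ^ 2 * x ^ 2)).
  { rewrite <- !sqrt_mult by lra; apply sqrt_lt_1_alt; split; [nra|].
    assert (k1 ^ 2 < k2 ^ 2) by nra; nra. }
  set (u := sqrt (1 - x ^ 2)) in *.
  set (a1 := sqrt (1 - k1 ^ 2 * x ^ 2)) in *.
  set (a2 := sqrt (1 - k2 ^ 2 * x ^ 2)) in *.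
  apply Rmult_lt_reg_r with (u * a1 * a2);
    [repeat apply Rmult_lt_0_compat; lra|].
  replace (sqrt (1 - k2 ^ 2) * / (u * a2) * (u * a1 * a2))
    with (sqrt (1 - k2 ^ 2) * a1) by (field; lra).
  replace (sqrt (1 - k1 ^ 2) * / (u * a1) * (u * a1 * a2))
    with (sqrt (1 - k1 ^ 2) * a2) by (field; lra).
  exact L.
Qed.

(* [ellipticK] increases while [sqrt (1 - k ^ 2) * ellipticK k] decreases, which
   squeezes [ellipticK] between its value at [k0] and a continuous function. *)
Lemma continuous_ellipticK (k0 : R) : 0 < k0 < 1 -> continuous ellipticK k0.
Proof.
  intros Hk0.
  set (phi := fun k => sqrt (1 - k0 ^ 2) * ellipticK k0 / sqrt (1 - k ^ 2)).
  assert (H0 := sqrt_lt_R0 _ (sq_lt_1 k0 ltac:(lra))).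
  assert (Ephi : phi k0 = ellipticK k0) by (unfold phi; field; lra).
  assert (Hphi : continuous phi k0).
  { apply (ex_derive_continuous (V := R_NormedModule)).
    assert (H := sq_lt_1 k0 ltac:(lra)).
    unfold phi; generalize (sqrt (1 - k0 ^ 2) * ellipticK k0); intros a.
    auto_derive; unfold Rminus in *; simpl in *; repeat split;
      try apply Rgt_not_eq; lra. }
  apply (filterlim_locally ellipticK); intros eps.
  assert (Hloc : locally k0 (fun k => 0 < k < 1)).
  { apply (open_and (fun k => 0 < k) (fun k => k < 1));
      [apply open_gt | apply open_lt | exact Hk0]. }
  assert (Hball := proj1 (filterlim_locally phi (phi k0)) Hphi eps).
  generalize (filter_and _ _ Hloc Hball); apply filter_imp; intros k [Hk Hb].
  rewrite Ephi in Hb.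
  assert (Hc := sqrt_lt_R0 _ (sq_lt_1 k ltac:(lra))).
  assert (Hmul : phi k * sqrt (1 - k ^ 2) = sqrt (1 - k0 ^ 2) * ellipticK k0)
    by (unfold phi; field; lra).
  apply Rabs_def2 in Hb; unfold minus, plus, opp in Hb; simpl in Hb.
  (* For [k < k0] the order is [phi k < ellipticK k < ellipticK k0]; for [k > k0] it is reversed. *)
  apply Rabs_def1; unfold minus, plus, opp; simpl;
    destruct (Rtotal_order k k0) as [Hlt | [-> | Hgt]]; try lra;
    try (assert (L1 := ellipticK_incr k k0 ltac:(lra) ltac:(lra) ltac:(lra));
         assert (L2 := compl_mul_ellipticK_decr k k0 ltac:(lra) ltac:(lra) ltac:(lra)));
    try (assert (L1 := ellipticK_incr k0 k ltac:(lra) ltac:(lra) ltac:(lra));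
         assert (L2 := compl_mul_ellipticK_decr k0 k ltac:(lra) ltac:(lra) ltac:(lra)));
    try (assert (phi k < ellipticK k) by nra);
    try (assert (ellipticK k < phi k) by nra); try lra; destruct eps; simpl in *; lra.
Qed.

(** * Complementary moduli, monotonicity and continuity of [mu] *)

Lemma compl_compl (r : R) : 0 < r < 1 -> sqrt (1 - sqrt (1 - r ^ 2) ^ 2) = r.
Proof.
  intros Hr; destruct (compl_sqrt r Hr) as [_ ->].
  replace (1 - (1 - r ^ 2)) with (r ^ 2) by ring; apply sqrt_pow2; lra.
Qed.

Lemma mu_pos (r : R) : 0 < r < 1 -> 0 < mu r.
Proof.
  intros Hr; unfold mu; apply Rmult_lt_0_compat; [assert (H := PI_RGT_0); lra|].
  apply Rdiv_lt_0_compat; apply ellipticK_pos; [apply compl_sqrt|]; exact Hr.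
Qed.

(** Passing to the complementary modulus inverts the quotient of elliptic integrals. *)
Lemma mu_mul_compl (r : R) : 0 < r < 1 ->
  mu r * mu (sqrt (1 - r ^ 2)) = PI ^ 2 / 4.
Proof.
  intros Hr; unfold mu; rewrite compl_compl by exact Hr.
  assert (H1 := ellipticK_pos r Hr).
  assert (H2 := ellipticK_pos _ (proj1 (compl_sqrt r Hr))).
  field; lra.
Qed.

(** As the modulus grows, the denominator rises and the numerator, taken at the complementary
    modulus, falls. *)
Lemma mu_decr (r1 r2 : R) : 0 < r1 -> r1 < r2 -> r2 < 1 -> mu r2 < mu r1.
Proof.
  intros H1 H12 H2; unfold mu.
  assert (Hc1 := proj1 (compl_sqrt r1 ltac:(lra))).
  assert (Hc2 := proj1 (compl_sqrt r2 ltac:(lra))).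
  assert (L1 := ellipticK_incr r1 r2 H1 H12 H2).
  assert (L2 : ellipticK (sqrt (1 - r2 ^ 2)) < ellipticK (sqrt (1 - r1 ^ 2))).
  { apply ellipticK_incr; try lra; apply sqrt_lt_1_alt.
    assert (Hq := sq_lt_1 r2 ltac:(lra)); split; [lra | nra]. }
  assert (P1 := ellipticK_pos r1 ltac:(lra)).
  assert (P2 := ellipticK_pos _ Hc2).
  apply Rmult_lt_compat_l; [assert (H := PI_RGT_0); lra|].
  apply Rmult_gt_0_lt_compat; try lra; [apply Rinv_0_lt_compat; lra|].
  apply Rinv_lt_contravar; [apply Rmult_lt_0_compat|]; lra.
Qed.

Lemma continuous_mu (r : R) : 0 < r < 1 -> continuous mu r.
Proof.
  intros Hr; unfold mu.
  destruct (compl_sqrt r Hr) as [Hc _].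
  apply (continuous_scal_r (V := R_NormedModule)).
  apply (continuous_mult (K := R_AbsRing)).
  - apply continuous_comp with (g := ellipticK); [|apply continuous_ellipticK, Hc].
    apply continuous_comp with (g := sqrt); [|apply continuous_sqrt].
    apply (ex_derive_continuous (V := R_NormedModule)); auto_derive; auto.
  - apply continuous_comp with (g := Rinv); [apply continuous_ellipticK, Hr|].
    apply continuous_Rinv; assert (H := ellipticK_pos r Hr); lra.
Qed.

(** * Lower and upper estimates of [mu] *)

Lemma artanh_lt_mu (r : R) : 0 < r < 1 -> artanh (sqrt (1 - r ^ 2)) < mu r.
Proof.
  intros Hr; destruct (compl_sqrt r Hr) as [Hc _]; unfold mu.
  assert (L1 := ellipticK_gt_artanh _ Hc).
  assert (L2 := ellipticK_lt r Hr).
  assert (P := ellipticK_pos r Hr).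
  assert (P' := ellipticK_pos _ Hc).
  set (c := sqrt (1 - r ^ 2)) in *.
  (* The first half is the artanh bound at [c]; the second is [ellipticK r < PI / (2 * c)]. *)
  apply Rlt_trans with (c * ellipticK c).
  - apply Rmult_lt_reg_r with (/ c); [apply Rinv_0_lt_compat; lra|].
    replace (c * ellipticK c * / c) with (ellipticK c) by (field; lra).
    exact L1.
  - apply Rmult_lt_reg_r with (ellipticK r / (c * ellipticK c)).
    { apply Rdiv_lt_0_compat; [lra | apply Rmult_lt_0_compat; lra]. }
    replace (c * ellipticK c * (ellipticK r / (c * ellipticK c)))
      with (ellipticK r) by (field; lra).
    replace (PI / 2 * (ellipticK c / ellipticK r)
               * (ellipticK r / (c * ellipticK c)))
      with (PI / (2 * c)) by (field; lra).
    exact L2.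
Qed.

(** With [a = sqrt y] and [b = sqrt (y + 1)], arcsinh of [a] is [ln (a + b)], and [(a + b) ^ 2 <= 2
    * (a ^ 2 + b ^ 2) = 2 + 4 * y]. *)
Lemma arcsinh_sqrt_le (y : R) : 0 < y -> arcsinh (sqrt y) <= ln (2 + 4 * y) / 2.
Proof.
  intros Hy; unfold arcsinh.
  assert (H := sqrt_lt_R0 _ Hy).
  assert (E := pow2_sqrt y ltac:(lra)).
  rewrite E.
  assert (H1 := sqrt_lt_R0 (y + 1) ltac:(lra)).
  assert (E1 := pow2_sqrt (y + 1) ltac:(lra)).
  set (a := sqrt y) in *; set (b := sqrt (y + 1)) in *.
  enough (ln ((a + b) ^ 2) <= ln (2 + 4 * y))
    by (rewrite ln_pow in *; simpl in *; lra).
  assert (0 <= (a - b) ^ 2) by apply pow2_ge_0.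
  apply ln_le; nra.
Qed.

Lemma mu_lt_ln (r : R) : 0 < r < 1 -> mu r < ln (1 + 4 / r).
Proof.
  intros Hr; destruct (compl_sqrt r Hr) as [Hc Ec]; unfold mu.
  assert (L1 := ellipticK_le_arcsinh _ Hc).
  assert (L2 := ellipticK_ge r Hr).
  assert (P := ellipticK_pos r Hr).
  set (k := sqrt (1 - r ^ 2)) in *.
  assert (Hz : 0 < (1 + k) / (1 - k)) by (apply Rdiv_lt_0_compat; lra).
  assert (La := arcsinh_sqrt_le _ Hz).
  (* Multiplied by [r ^ 2 = (1 - k) * (1 + k)], the arguments compare as [2 * r ^ 2 + 4 * (1 + k) ^
     2 < (r + 4) ^ 2], true since [k] and [r] are below 1. *)
  assert (Lb : ln (2 + 4 * ((1 + k) / (1 - k))) < 2 * ln (1 + 4 / r)).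
  { assert (Hr4 : 0 < 4 / r) by (apply Rdiv_lt_0_compat; lra).
    replace (2 * ln (1 + 4 / r)) with (ln ((1 + 4 / r) ^ 2))
      by (rewrite ln_pow by lra; simpl; ring).
    apply ln_increasing; [lra|].
    assert (Hrk : r ^ 2 = (1 - k) * (1 + k)) by nra.
    apply Rmult_lt_reg_r with (r ^ 2); [nra|].
    replace ((1 + 4 / r) ^ 2 * r ^ 2) with ((r + 4) ^ 2) by (field; lra).
    replace ((2 + 4 * ((1 + k) / (1 - k))) * r ^ 2)
      with (2 * r ^ 2 + 4 * (1 + k) ^ 2) by (rewrite Hrk; field; lra).
    nra. }
  assert (Lc : ellipticK k < 2 / (1 + k) * ln (1 + 4 / r)).
  { apply Rle_lt_trans with (1 := L1).
    apply Rmult_lt_compat_l; [apply Rdiv_lt_0_compat; lra | lra]. }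
  assert (Pi := PI_RGT_0).
  apply Rmult_lt_reg_r with (ellipticK r); [lra|].
  replace (PI / 2 * (ellipticK k / ellipticK r) * ellipticK r)
    with (PI / 2 * ellipticK k) by (field; lra).
  assert (Hln : 0 < ln (1 + 4 / r)).
  { rewrite <- ln_1; apply ln_increasing; [lra|].
    assert (0 < 4 / r) by (apply Rdiv_lt_0_compat; lra); lra. }
  (* The factors [1 + k] of the two elliptic bounds cancel here. *)
  apply Rlt_le_trans with (ln (1 + 4 / r) * (PI / (1 + k))).
  - replace (ln (1 + 4 / r) * (PI / (1 + k)))
      with (PI / 2 * (2 / (1 + k) * ln (1 + 4 / r))) by (field; lra).
    apply Rmult_lt_compat_l; lra.
  - apply Rmult_le_compat_l; lra.
Qed.

(** * Surjectivity of [mu] and its inverse *)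

Lemma artanh_surj (t : R) : 0 < t -> exists x, 0 < x < 1 /\ artanh x = t.
Proof.
  intros Ht.
  assert (H : 1 < exp (2 * t)) by (rewrite <- exp_0; apply exp_increasing; lra).
  (* This is the hyperbolic tangent of [t]. *)
  exists ((exp (2 * t) - 1) / (exp (2 * t) + 1)); split.
  - split; [apply Rdiv_lt_0_compat; lra|].
    apply Rmult_lt_reg_r with (exp (2 * t) + 1); [lra|].
    replace ((exp (2 * t) - 1) / (exp (2 * t) + 1) * (exp (2 * t) + 1))
      with (exp (2 * t) - 1) by (field; lra); lra.
  - unfold artanh.
    replace ((1 + (exp (2 * t) - 1) / (exp (2 * t) + 1))
               / (1 - (exp (2 * t) - 1) / (exp (2 * t) + 1)))
      with (exp (2 * t)) by (field; lra).
    rewrite ln_exp; field.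
Qed.

Lemma mu_surj (y : R) : 0 < y -> exists r, 0 < r < 1 /\ mu r = y.
Proof.
  intros Hy.
  assert (Hpi : 0 < PI ^ 2 / 4) by (assert (H := PI_RGT_0); nra).
  (* Bracketing points: [r1], the complement of [t1], has [mu r1 > y]; at [r2] the complementary
     modulus has [mu] above [PI ^ 2 / 4 / y], so [mu r2 < y]. *)
  destruct (artanh_surj y Hy) as [t1 [Ht1 E1]].
  destruct (artanh_surj (PI ^ 2 / 4 / y)) as [r2 [Hr2 E2]];
    [apply Rdiv_lt_0_compat; lra|].
  destruct (compl_sqrt t1 Ht1) as [Hr1 _]; set (r1 := sqrt (1 - t1 ^ 2)) in *.
  assert (L1 : y < mu r1).
  { rewrite <- E1, <- (compl_compl t1 Ht1); apply artanh_lt_mu, Hr1. }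
  assert (L2 : mu r2 < y).
  { destruct (compl_sqrt r2 Hr2) as [Hc _].
    assert (La := artanh_lt_mu _ Hc); rewrite compl_compl, E2 in La by exact Hr2.
    assert (Em := mu_mul_compl r2 Hr2).
    assert (P := mu_pos r2 Hr2).
    assert (Hmul := Rmult_lt_compat_l _ _ _ P La); rewrite Em in Hmul.
    apply Rmult_lt_reg_r with (PI ^ 2 / 4 / y); [apply Rdiv_lt_0_compat; lra|].
    replace (y * (PI ^ 2 / 4 / y)) with (PI ^ 2 / 4) by (field; lra); exact Hmul. }
  assert (H12 : r1 < r2).
  { apply Rnot_le_lt; intros [Hlt | Heq].
    - assert (H := mu_decr r2 r1 ltac:(lra) Hlt ltac:(lra)); lra.
    - rewrite Heq in L2; lra. }
  (* Written as [y - mu r] so that the sign goes from negative to positive. *)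
  destruct (IVT_interv (fun r => y - mu r) r1 r2) as [r [Hr Er]]; try lra.
  - intros a Ha; apply continuity_pt_filterlim.
    apply (continuous_minus (V := R_NormedModule)); [apply continuous_const|].
    apply continuous_mu; lra.
  - exists r; split; lra.
Qed.

(** [iota] requires a unique solution: existence is [mu_surj], uniqueness is strict monotonicity. *)
Lemma mu_inv_correct (y : R) : 0 < y -> 0 < mu_inv y < 1 /\ mu (mu_inv y) = y.
Proof.
  intros Hy; apply (iota_correct (fun r => 0 < r < 1 /\ mu r = y)).
  destruct (mu_surj y Hy) as [r [Hr Er]].
  exists r; split; [split; assumption|]; intros r' [Hr' Er'].
  destruct (Rtotal_order r r') as [Hlt | [Heq | Hgt]]; [|exact Heq|].
  - assert (H := mu_decr r r' ltac:(lra) Hlt ltac:(lra)); lra.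
  - assert (H := mu_decr r' r ltac:(lra) Hgt ltac:(lra)); lra.
Qed.

(** Reduces each bound on [mu_inv] to an estimate of [mu] at an explicit modulus. *)
Lemma lt_of_mu_lt (r1 r2 : R) : 0 < r1 < 1 -> 0 < r2 < 1 ->
  mu r2 < mu r1 -> r1 < r2.
Proof.
  intros H1 H2 Hmu; apply Rnot_le_lt; intros [Hlt | Heq].
  - assert (H := mu_decr r2 r1 ltac:(lra) Hlt ltac:(lra)); lra.
  - rewrite Heq in Hmu; lra.
Qed.

(** * The two inequalities for [c1] *)

Theorem lemma1p6 (K : R) (hK : 1 < K) :
  let c1 := mu_inv (ln ((sqrt K + 1) / (sqrt K - 1))) in
  (K - 1) / (K + 1) < c1 < 2 * ((K - 1) / (sqrt K + 1)).
Proof.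
  intros c1; unfold c1; clear c1.
  assert (Hs : 1 < sqrt K) by (rewrite <- sqrt_1; apply sqrt_lt_1_alt; lra).
  assert (EK : sqrt K ^ 2 = K) by (apply pow2_sqrt; lra).
  set (s := sqrt K) in *.
  assert (Hy : 0 < ln ((s + 1) / (s - 1))).
  { rewrite <- ln_1; apply ln_increasing; [lra|].
    apply Rmult_lt_reg_r with (s - 1); [lra|].
    replace ((s + 1) / (s - 1) * (s - 1)) with (s + 1) by (field; lra); lra. }
  destruct (mu_inv_correct _ Hy) as [Hc Emu].
  set (c1 := mu_inv _) in *; rewrite <- EK.
  replace (2 * ((s ^ 2 - 1) / (s + 1))) with (2 * (s - 1)) by (field; lra).
  split.
  - assert (Hd : 0 < s ^ 2 + 1) by nra.
    assert (Hr : 0 < (s ^ 2 - 1) / (s ^ 2 + 1) < 1).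
    { split; [apply Rdiv_lt_0_compat; nra|].
      apply Rmult_lt_reg_r with (s ^ 2 + 1); [lra|].
      replace ((s ^ 2 - 1) / (s ^ 2 + 1) * (s ^ 2 + 1)) with (s ^ 2 - 1)
        by (field; lra); lra. }
    apply lt_of_mu_lt; [exact Hr | exact Hc |]; rewrite Emu.
    replace (ln ((s + 1) / (s - 1)))
      with (artanh (sqrt (1 - ((s ^ 2 - 1) / (s ^ 2 + 1)) ^ 2)));
      [apply artanh_lt_mu, Hr|].
    (* The complementary modulus is [2 * s / (s ^ 2 + 1)], whose artanh is half the logarithm of
       [((s + 1) / (s - 1)) ^ 2]. *)
    replace (1 - ((s ^ 2 - 1) / (s ^ 2 + 1)) ^ 2)
      with ((2 * s / (s ^ 2 + 1)) ^ 2) by (field; lra).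
    rewrite sqrt_pow2 by (apply Rlt_le, Rdiv_lt_0_compat; lra).
    unfold artanh.
    replace ((1 + 2 * s / (s ^ 2 + 1)) / (1 - 2 * s / (s ^ 2 + 1)))
      with (((s + 1) / (s - 1)) ^ 2)
      by (field; repeat split; nra).
    rewrite ln_pow by (apply Rdiv_lt_0_compat; lra); simpl; field.
  (* If [2 * (s - 1)] is at least 1, then [c1 < 1] suffices; otherwise it is a modulus to which
     [mu_lt_ln] applies. *)
  - destruct (Rle_or_lt 1 (2 * (s - 1))) as [Hbig | Hsmall]; [lra|].
    apply lt_of_mu_lt; [exact Hc | lra |]; rewrite Emu.
    replace ((s + 1) / (s - 1)) with (1 + 2 / (s - 1)) by (field; lra).
    replace (2 / (s - 1)) with (4 / (2 * (s - 1))) by (field; lra).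
    apply mu_lt_ln; lra.
Qed.
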